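(* Let $n\geq 5$, let $B_n'$ be the commutator subgroup of the braid group $B_n$ on $n$ strands, and let $G$ be a finite group. If $f\colon B_n'\rightarrow G$ is not the trivial homomorphism, then \[ |G| \geq 2^{\lfloor n/2\rfloor-2}\left(\lfloor n/2\rfloor-1\right)!. \] *)

(* Defs.v *)
(* The braid group B_n is given by its Artin presentation:
   words in the letters sigma_i^{+-1} (i < n-1) modulo the smallest
   congruence containing free cancellation and the braid relations. *)
From mathcomp Require Import all_boot all_order all_algebra all_fingroup.
Set Implicit Arguments. Unset Strict Implicit. Unset Printing Implicit Defensive.

(* a letter (i, b) is sigma_i if b = false and sigma_i^{-1} if b = true;
   generators indexed by 'I_(n-1), i.e. sigma_1..sigma_{n-1} shifted to 0..n-2 *)
Definition bletter (n : nat) := ('I_n.-1 * bool)%type.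
Definition bword (n : nat) := seq (bletter n).

Definition binv n (w : bword n) : bword n := rev (map (fun l => (l.1, ~~ l.2)) w).

Definition sg n (i : 'I_n.-1) : bletter n := (i, false).

Inductive braid_eq (n : nat) : bword n -> bword n -> Prop :=
| beq_refl w : braid_eq w w
| beq_sym w1 w2 : braid_eq w1 w2 -> braid_eq w2 w1
| beq_trans w1 w2 w3 : braid_eq w1 w2 -> braid_eq w2 w3 -> braid_eq w1 w3
| beq_ctx u v w1 w2 : braid_eq w1 w2 -> braid_eq (u ++ w1 ++ v) (u ++ w2 ++ v)
| beq_cancel (i : 'I_n.-1) (b : bool) : braid_eq [:: (i, b); (i, ~~ b)] [::]
| beq_far (i j : 'I_n.-1) : (i.+1 < j)%N ->
    braid_eq [:: sg i; sg j] [:: sg j; sg i]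
| beq_braid (i j : 'I_n.-1) : j = i.+1 :> nat ->
    braid_eq [:: sg i; sg j; sg i] [:: sg j; sg i; sg j].

Definition bcomm n (u v : bword n) : bword n := binv u ++ binv v ++ u ++ v.

Definition in_commutator n (w : bword n) : Prop :=
  exists s : seq (bword n * bword n),
    braid_eq w (flatten (map (fun p => bcomm p.1 p.2) s)).

Definition is_hom_commutator n (gT : finGroupType) (f : bword n -> gT) : Prop :=
  (forall w1 w2, in_commutator w1 -> in_commutator w2 ->
     braid_eq w1 w2 -> f w1 = f w2) /\
  (forall w1 w2, in_commutator w1 -> in_commutator w2 ->
     f (w1 ++ w2) = (f w1 * f w2)%g).

(* Main.v *)
Require Import Defs.
From mathcomp Require Import all_boot all_order all_algebra all_fingroup.
From mathcomp Require Import zify.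
From Stdlib Require Import Setoid Morphisms.

(** Let m = floor(n/2) and s = sigma_(2m-1). The m-1 elements
    x_i = sigma_(2i-1) s^-1 of B_n' commute, and each adjacent transposition of
    them is realised by conjugation in B_n': swap sigma_(2i-1) and sigma_(2i+1) by
    a 4-strand braid, and correct its exponent sum by a power of s, which commutes
    with all the x_j.  If the images y_i in G are distinct, the elements
    (prod_(i in S) y_i) c_w, where S avoids one fixed index and c_w induces the
    permutation w, are pairwise distinct, and there are 2^(m-2) (m-1)! of them.
    Otherwise all y_i agree, so f kills sigma_1 sigma_3^-1; as sigma_5 centralises
    this element, f kills its normal closure in B_n, which is B_n' because
    identifying sigma_1 with sigma_3 identifies all the generators. *)
Set Implicit Arguments. Unset Strict Implicit. Unset Printing Implicit Defensive.

(** * Counting with commuting, permutable elements of a finite group *)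

Section TotallySymmetric.

Variables (gT : finGroupType) (k : nat).
Variables (y : 'I_k.+1 -> gT) (c : 'S_k.+1 -> gT).
Hypotheses (y_inj : injective y) (y_comm : forall i j, commute (y i) (y j)).
Hypothesis y_conj : forall s i, (y i ^ c s)%g = y (s i).

Let yprod (S : {set 'I_k.+1}) : gT := (\prod_(i in S) y i)%g.

Lemma prod_conj (s : 'S_k.+1) (r : seq 'I_k.+1) (S : {set 'I_k.+1}) :
  ((\prod_(i <- r | i \in S) y i) ^ c s = \prod_(i <- r | i \in S) y (s i))%g.
Proof.
rewrite (big_morph (conjg^~ (c s)) (fun u v => conjMg u v _) (conj1g _)).
by apply: eq_bigr => i _; rewrite y_conj.
Qed.

(* If a lies in S but not in T, conjugating by the transposition (0 a) fixes the
   product over T and turns the factor y a of the product over S into y 0. *)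
Lemma yprod_sub (S T : {set 'I_k.+1}) :
  ord0 \notin S -> ord0 \notin T -> yprod S = yprod T -> S \subset T.
Proof.
move=> S0 T0 eST; apply/subsetP => a aS; apply/negPn/negP => aT.
have fixT i : i != a -> i != ord0 -> tperm ord0 a i = i.
  by move=> ia i0; rewrite tpermD // eq_sym.
have := congr1 (fun z => z ^ c (tperm ord0 a))%g eST.
have -> : (yprod T ^ c (tperm ord0 a))%g = yprod T.
  rewrite /yprod prod_conj; apply: eq_bigr => i iT; rewrite fixT //.
    by apply: contraNneq aT => <-.
  by apply: contraNneq T0 => <-.
rewrite -{}eST /yprod prod_conj.
(* Splitting the enumeration at [a] isolates one factor; the factors around it are unmoved and
   cancel, leaving [y ord0 = y a]. *)
have := index_enum_uniq 'I_k.+1; have := mem_index_enum a.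
case/splitPr => r1 r2; rewrite cat_uniq /= => /and3P[_ /norP[ar1 _] /andP[ar2 _]].
rewrite !big_cat !big_cons aS tpermR.
have fix_r r : a \notin r ->
    (\prod_(i <- r | i \in S) y (tperm ord0 a i) = \prod_(i <- r | i \in S) y i)%g.
  move=> ar; rewrite big_seq_cond [RHS]big_seq_cond.
  apply: eq_bigr => i /andP[ir iS]; rewrite fixT //.
    by apply: contraNneq ar => <-.
  by apply: contraNneq S0 => <-.
rewrite !{}fix_r // => /mulgI /mulIg /y_inj a0.
by rewrite a0 aS in S0.
Qed.

(** Since [yprod S] centralises every [y i], the action of [yprod S * c s] on the [y i] by
    conjugation determines [s]; cancelling [c s] leaves [yprod_sub], applied both ways. *)
Lemma totally_symmetric_card : 2 ^ k * (k.+1)`! <= #|gT|.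
Proof.
pose D := setX (powerset [set~ (ord0 : 'I_k.+1)]) [set: 'S_k.+1].
have <- : #|D| = 2 ^ k * (k.+1)`!.
  by rewrite cardsX card_powerset cardsC1 card_ord cardsT card_Sn.
pose F (p : {set 'I_k.+1} * 'S_k.+1) := (yprod p.1 * c p.2)%g.
have Finj : {in D &, injective F}.
  have no0 (S : {set 'I_k.+1}) : S \in powerset [set~ ord0] -> ord0 \notin S.
    by rewrite powersetE => /subsetP SC; apply/negP => /SC; rewrite !inE eqxx.
  move=> [S s] [T t]; rewrite !in_setX /= => /andP[/no0 S0 _] /andP[/no0 T0 _].
  rewrite /F /= => eF.
  have triv U i : (y i ^ yprod U)%g = y i.
    suff cy : commute (y i) (yprod U) by rewrite conjgE cy mulKg.
    rewrite /yprod; apply: (big_ind (commute (y i))) => [|u v|j _].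
    - by rewrite /commute mulg1 mul1g.
    - exact: commuteM.
    - exact: y_comm.
  have est : s = t.
    apply/permP => i; apply: y_inj.
    by rewrite -!y_conj -[in LHS](triv S) -[in RHS](triv T) -!conjgM eF.
  subst t; move/mulIg: eF => eST.
  by congr (_, _); apply/eqP; rewrite eqEsubset !yprod_sub.
by rewrite -(card_in_imset Finj) max_card.
Qed.

End TotallySymmetric.

(** The permutations realised by conjugation form a group; by induction on [j], adjacent
    transpositions conjugate one another into the generators [tperm ord0 j]. *)
Lemma realizable_perm (gT : finGroupType) (k : nat) (y : 'I_k.+1 -> gT) :
  (forall i j : 'I_k.+1, j = i.+1 :> nat ->
     exists g, forall l, (y l ^ g)%g = y (tperm i j l)) ->
  forall s : 'S_k.+1, exists g, forall l, (y l ^ g)%g = y (s l).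
Proof.
move=> adj.
pose R := [set s : 'S_k.+1 | [exists g, [forall l, (y l ^ g)%g == y (s l)]]].
have RP (s : 'S_k.+1) : reflect (exists g, forall l, (y l ^ g)%g = y (s l)) (s \in R).
  rewrite inE; apply: (iffP existsP) => -[g Hg]; exists g.
    by move=> l; apply/eqP; exact: (forallP Hg).
  by apply/forallP => l; apply/eqP.
have grR : group_set R.
  apply/group_setP; split; first by apply/RP; exists 1%g => l; rewrite conjg1 perm1.
  move=> s t /RP[g Hg] /RP[h Hh]; apply/RP; exists (g * h)%g => l.
  by rewrite conjgM Hg Hh permM.
have R0 (m : nat) : forall j : 'I_k.+1, j = m :> nat -> tperm ord0 j \in Group grR.
  elim: m => [|m IH] j jm.
    have -> : j = ord0 by apply: val_inj.
    by rewrite tperm1 group1.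
  have mk : m < k.+1 by have := ltn_ord j; lia.
  pose i := Ordinal mk.
  have ijR : tperm i j \in Group grR by apply/RP/adj.
  case: (eqVneq i ord0) => [<- //|i0].
  have -> : tperm ord0 j = (tperm ord0 i ^ tperm i j)%g.
    rewrite tpermJ tpermL tpermD //.
    by apply/eqP => /(congr1 val) /=; lia.
  by rewrite groupJ // IH.
move=> s; apply/RP.
have : s \in [set: 'S_k.+1] by rewrite inE.
rewrite -(gen_tperm ord0); apply/subsetP.
rewrite -[R]/(gval (Group grR)) gen_subG.
by apply/subsetP => _ /imsetP[j _ ->]; apply: (R0 j).
Qed.

(** * Word calculus in the braid group *)

Section BraidWords.

Variable n : nat.
Implicit Types (u v w g x : bword n) (i j l : 'I_n.-1).

Local Notation "u ≡ v" := (braid_eq u v) (at level 70).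

#[local] Instance braid_eq_equiv : Equivalence (@braid_eq n).
Proof. split; [exact: beq_refl | exact: beq_sym | exact: beq_trans]. Qed.

#[local] Hint Extern 0 (braid_eq _ _) => exact: beq_refl : core.

#[local] Instance cat_braid_eq :
  Proper (@braid_eq n ==> @braid_eq n ==> @braid_eq n) (@cat (bletter n)).
Proof.
move=> u u' eu v v' ev; transitivity (u' ++ v).
  exact: (beq_ctx [::] v eu).
by have := beq_ctx u' [::] ev; rewrite !cats0.
Qed.

Lemma binv_cat u v : binv (u ++ v) = binv v ++ binv u.
Proof. by rewrite /binv map_cat rev_cat. Qed.

Lemma binvK : involutive (@binv n).
Proof.
move=> w; rewrite /binv map_rev revK -map_comp -[RHS]map_id.
by apply: eq_map => -[i b] /=; rewrite negbK.
Qed.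

Lemma binv_cons a w : binv (a :: w) = binv w ++ binv [:: a].
Proof. by rewrite -cat1s binv_cat. Qed.

Lemma mulwV w : w ++ binv w ≡ [::].
Proof.
elim: w => [|[i b] w IH]; first reflexivity.
rewrite binv_cons -cat1s -catA (catA w) IH; exact: beq_cancel.
Qed.

Lemma mulVw w : binv w ++ w ≡ [::].
Proof. by have := mulwV (binv w); rewrite binvK. Qed.

Lemma mulVKw u w : binv u ++ (u ++ w) ≡ w.
Proof. by rewrite catA mulVw. Qed.

Lemma cat_binv_cancel u v w : (u ++ binv w) ++ binv (v ++ binv w) ≡ u ++ binv v.
Proof. by rewrite binv_cat binvK -catA mulVKw. Qed.

#[local] Instance binv_braid_eq : Proper (@braid_eq n ==> @braid_eq n) (@binv n).
Proof.
move=> u v euv; have := beq_ctx (binv u) (binv v) euv.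
by rewrite mulVKw mulwV cats0 => /beq_sym.
Qed.

(** Stands for [g x g^-1 = y], free of inverses so that braid relations are instances of it;
    [intertwines g x x] expresses commutation. *)
Definition intertwines g x y := g ++ x ≡ y ++ g.

Lemma intertwines_conj g x y : intertwines g x y -> g ++ x ++ binv g ≡ y.
Proof. by rewrite /intertwines catA => ->; rewrite -catA mulwV cats0. Qed.

Lemma conj_intertwines g x : intertwines g x (g ++ x ++ binv g).
Proof. by rewrite /intertwines -!catA mulVw cats0. Qed.

Lemma intertwines_cat g x1 x2 y1 y2 :
  intertwines g x1 y1 -> intertwines g x2 y2 ->
  intertwines g (x1 ++ x2) (y1 ++ y2).
Proof. by rewrite /intertwines => h1 h2; rewrite catA h1 -catA h2 catA. Qed.

Lemma intertwines_inv g x y :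
  intertwines g x y -> intertwines g (binv x) (binv y).
Proof.
rewrite /intertwines => h.
by rewrite -(mulVKw y (g ++ binv x)) (catA y) -h -catA mulwV cats0.
Qed.

Lemma intertwines_comp g h x y z :
  intertwines h x y -> intertwines g y z -> intertwines (g ++ h) x z.
Proof. by rewrite /intertwines => h1 h2; rewrite -catA h1 catA h2 catA. Qed.

Lemma intertwines_sym g x y : intertwines g x y -> intertwines (binv g) y x.
Proof.
rewrite /intertwines => h.
by rewrite -(mulVKw g (x ++ binv g)) (catA g) h -!catA mulwV cats0.
Qed.

Lemma commutes_sym x y : intertwines x y y -> intertwines y x x.
Proof. by rewrite /intertwines => ->. Qed.

(** * Conjugation of generators by short braids *)

Definition gen i : bword n := [:: sg i].

Lemma gen_far i j : (i.+1 < j) || (j.+1 < i) -> intertwines (gen i) (gen j) (gen j).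
Proof.
case/orP => h; first exact: beq_far.
by apply: commutes_sym; exact: beq_far.
Qed.

Lemma gen_braid i j : j = i.+1 :> nat ->
  gen i ++ gen j ++ gen i ≡ gen j ++ gen i ++ gen j.
Proof. exact: beq_braid. Qed.

Lemma gen_next i j : j = i.+1 :> nat -> intertwines (gen i ++ gen j) (gen i) (gen j).
Proof. by move=> ij; rewrite /intertwines -catA; exact: gen_braid. Qed.

Lemma gen_far_tail i l w : i.+1 < l -> gen i ++ (gen l ++ w) ≡ gen l ++ (gen i ++ w).
Proof. by move=> il; rewrite !catA (gen_far (i := i) (j := l)) ?il. Qed.

Lemma gen_braid_tail i j w : j = i.+1 :> nat ->
  gen i ++ (gen j ++ (gen i ++ w)) ≡ gen j ++ (gen i ++ (gen j ++ w)).
Proof. by move/gen_braid => ij; have := beq_ctx [::] w ij; rewrite -!catA. Qed.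

(** A single braid moves both neighbours up, so it conjugates [gen i ++ binv (gen j)] to
    [gen j ++ binv (gen l)]. *)
Lemma gen_shift i j l : j = i.+1 :> nat -> l = j.+1 :> nat ->
  intertwines (gen i ++ gen j ++ gen l) (gen i) (gen j) /\
  intertwines (gen i ++ gen j ++ gen l) (gen j) (gen l).
Proof.
move=> ij jl; have il : i.+1 < l by lia.
rewrite /intertwines -!catA; split.
  by rewrite -(gen_far (i := i) (j := l)) ?il // (gen_braid_tail _ ij).
by rewrite (gen_braid jl) (gen_far_tail _ il).
Qed.

(** For consecutive indices, two adjacent strands cross the next two, and each pair carries its own
    generator along. *)
Definition swap i j l : bword n := gen j ++ gen i ++ gen l ++ gen j.

Lemma swapP i j l : j = i.+1 :> nat -> l = j.+1 :> nat ->
  intertwines (swap i j l) (gen i) (gen l) /\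
  intertwines (swap i j l) (gen l) (gen i).
Proof.
move=> ij jl; have il : i.+1 < l by lia.
rewrite /intertwines /swap -!catA; split.
  by rewrite (gen_far_tail _ il) (gen_braid ij) (gen_braid_tail _ jl) -(gen_far_tail _ il).
by rewrite -(gen_braid jl) -(gen_braid_tail _ ij).
Qed.

(* The retraction of B_n onto the infinite cyclic group generated by the letter
   c: the exponent sum, kept as a word. *)
Definition collapse c w : bword n := map (fun a => (c, a.2)) w.

Lemma collapse_cat c u v : collapse c (u ++ v) = collapse c u ++ collapse c v.
Proof. exact: map_cat. Qed.

Lemma collapse_binv c w : collapse c (binv w) = binv (collapse c w).
Proof. by rewrite /collapse /binv map_rev -!map_comp. Qed.

Lemma collapse_braid_eq c u v : u ≡ v -> collapse c u ≡ collapse c v.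
Proof.
elim=> {u v} [w|u v _ IH|u v w _ IH1 _ IH2|u v w1 w2 _ IH|i b|i j _|i j _] /=.
- reflexivity.
- by symmetry.
- by transitivity (collapse c v).
- by rewrite !collapse_cat IH.
- exact: beq_cancel.
- reflexivity.
- reflexivity.
Qed.

Lemma intertwines_nil g : intertwines g [::] [::].
Proof. by rewrite /intertwines cats0. Qed.

Lemma intertwines_collapse g c w :
  intertwines g (gen c) (gen c) -> intertwines g (collapse c w) (collapse c w).
Proof.
move=> gc; elim: w => [|[i b] w IH]; first exact: intertwines_nil.
rewrite /= -cat1s; apply: intertwines_cat => //.
by case: b => //; exact: (intertwines_inv gc).
Qed.

Lemma collapse_commute c u v :
  intertwines (collapse c u) (collapse c v) (collapse c v).
Proof.
apply: intertwines_collapse; apply: commutes_sym.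
by apply: intertwines_collapse; exact: beq_refl.
Qed.

(** The image of [collapse] is cyclic, hence abelian. *)
Lemma collapse_commutator c w : in_commutator w -> collapse c w ≡ [::].
Proof.
case=> s /(collapse_braid_eq c) ->; elim: s => [|[u v] s IH] /=; first reflexivity.
rewrite collapse_cat IH /bcomm !collapse_cat !collapse_binv cats0.
have cuv : collapse c u ++ collapse c v ≡ collapse c v ++ collapse c u.
  exact: collapse_commute.
by rewrite cuv mulVKw mulVw.
Qed.

(** * Normal subgroups of the braid group, as predicates on words *)

Record normal_words (K : bword n -> Prop) : Prop := NormalWords {
  nw_eq : forall u v, u ≡ v -> K u -> K v;
  nw_nil : K [::];
  nw_cat : forall u v, K u -> K v -> K (u ++ v);
  nw_inv : forall u, K u -> K (binv u);
  nw_conj : forall g u, K u -> K (g ++ u ++ binv g) }.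

Lemma nw_intertwines K g x y :
  normal_words K -> intertwines g x y -> K x -> K y.
Proof.
by move=> nK /intertwines_conj gxy /(nw_conj nK g); exact: nw_eq.
Qed.

Lemma nw_gen_equal K : normal_words K ->
  (forall i j, j = i.+1 :> nat -> K (gen i ++ binv (gen j))) ->
  forall i j, K (gen i ++ binv (gen j)).
Proof.
move=> nK K1.
have K2 m : forall i j, j = i + m :> nat -> K (gen i ++ binv (gen j)).
  elim: m => [|m IH] i j ij.
    have -> : i = j by apply: val_inj => /=; lia.
    by apply: nw_eq (nw_nil nK) => //; symmetry; exact: mulwV.
  have lP : i.+1 < n.-1 by have := ltn_ord j; lia.
  have := nw_cat nK (K1 i (Ordinal lP) erefl) (IH (Ordinal lP) j _).
  rewrite -catA => /(_ ltac:(rewrite /=; lia)).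
  by apply: nw_eq => //; rewrite mulVKw.
move=> i j; case: (leqP i j) => ij; first by apply: (K2 (j - i)); lia.
have := nw_inv nK (K2 (i - j) j i ltac:(lia)).
by rewrite binv_cat binvK.
Qed.

(** Modulo [K] every generator equals [c]. In the induction the element for the tail is conjugated
    by the collapsed head letter, so that the two factors telescope. *)
Lemma nw_collapse K c : normal_words K ->
  (forall i, K (gen i ++ binv (gen c))) -> forall w, K (w ++ binv (collapse c w)).
Proof.
move=> nK Kg; elim=> [|[i b] w IH]; first exact: (nw_nil nK).
have Kl : K ([:: (i, b)] ++ binv [:: (c, b)]).
  case: b; last exact: Kg.
  (* For an inverse letter, [sigma_i^-1 c] is the inverse of [c^-1 sigma_i], a conjugate of
     [sigma_i c^-1]. *)
  have := nw_inv nK (nw_conj nK (binv (gen i)) (Kg i)).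
  apply: nw_eq => //; rewrite !binv_cat !binvK.
  change (binv [:: (c, true)]) with (gen c).
  change [:: (i, true)] with (binv (gen i)).
  by rewrite -!catA mulVw cats0.
have := nw_cat nK Kl (nw_conj nK [:: (c, b)] IH).
apply: nw_eq => //.
change (collapse c ((i, b) :: w)) with ((c, b) :: collapse c w).
rewrite (binv_cons (c, b) (collapse c w)) -(cat1s (i, b) w).
by rewrite -!catA mulVKw.
Qed.

Lemma nw_commutator K c : normal_words K ->
  (forall i, K (gen i ++ binv (gen c))) -> forall w, in_commutator w -> K w.
Proof.
move=> nK Kg w /(collapse_commutator c) wc.
have := nw_collapse nK Kg w.
by apply: nw_eq => //; rewrite wc cats0.
Qed.

Lemma conj_bcomm g u v :
  g ++ bcomm u v ++ binv g ≡ bcomm (g ++ u ++ binv g) (g ++ v ++ binv g).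
Proof.
by rewrite /bcomm !binv_cat !binvK -!catA !mulVKw.
Qed.

Lemma in_commutator_normal : normal_words (@in_commutator n).
Proof.
split.
- by move=> u v euv [s es]; exists s; rewrite -euv.
- by exists [::].
- by move=> u v [s es] [t et]; exists (s ++ t); rewrite map_cat flatten_cat es et.
- move=> u [s es]; exists (rev (map (fun p => (p.2, p.1)) s)); rewrite {u}es.
  elim: s => [|[u v] s IH]; first reflexivity.
  rewrite /= rev_cons map_rcons flatten_rcons binv_cat IH.
  by rewrite /bcomm !binv_cat !binvK -!catA.
- move=> g u [s es].
  exists (map (fun p => (g ++ p.1 ++ binv g, g ++ p.2 ++ binv g)) s); rewrite {u}es.
  elim: s => [|[u v] s IH]; first exact: mulwV.
  by rewrite /= -IH -conj_bcomm -!catA mulVKw.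
Qed.

Lemma in_commutator_gen i j : in_commutator (gen i ++ binv (gen j)).
Proof.
apply: nw_gen_equal i j => [|i j ij]; first exact: in_commutator_normal.
pose g := gen i ++ gen j.
rewrite -[gen i ++ _]binvK; apply: (nw_inv in_commutator_normal).
(* As [bcomm] starts with the inverses of its arguments, these give [g sigma_i g^-1 sigma_i^-1 =
   sigma_j sigma_i^-1]. *)
exists [:: (binv g, binv (gen i))].
change (binv (gen i ++ binv (gen j)) ≡ bcomm (binv g) (binv (gen i)) ++ [::]).
rewrite cats0 /bcomm !binvK binv_cat binvK.
by rewrite -{1}(intertwines_conj (gen_next ij)) -!catA.
Qed.

Lemma in_commutator_collapse c w : in_commutator (w ++ binv (collapse c w)).
Proof.
by apply: nw_collapse => [|i]; [exact: in_commutator_normal | exact: in_commutator_gen].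
Qed.

(** * Homomorphisms on the commutator subgroup and their kernels *)

Section Homomorphism.

Variables (gT : finGroupType) (f : bword n -> gT).
Hypothesis fhom : is_hom_commutator f.

Lemma hom_eq u v : in_commutator u -> u ≡ v -> f u = f v.
Proof.
move=> Cu uv; apply: fhom.1 => //; exact: nw_eq in_commutator_normal _ _ uv Cu.
Qed.

Lemma hom_nil : f [::] = 1%g.
Proof.
have C0 := nw_nil in_commutator_normal.
by apply: (mulgI (f [::])); rewrite -fhom.2 // mulg1.
Qed.

Lemma hom_inv u : in_commutator u -> f (binv u) = (f u)^-1%g.
Proof.
move=> Cu; have CV := nw_inv in_commutator_normal Cu.
apply: (mulgI (f u)); rewrite -fhom.2 // mulgV -hom_nil.
apply: hom_eq; last exact: mulwV.
exact: nw_cat in_commutator_normal _ _ Cu CV.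
Qed.

(** Here [y ^ g] means [g^-1 y g], so the direction from [x] to [y] is reversed on images. *)
Lemma hom_intertwines g x y : in_commutator g -> in_commutator x ->
  intertwines g x y -> (f y ^ f g)%g = f x.
Proof.
move=> Cg Cx gxy; have Cy := nw_intertwines in_commutator_normal gxy Cx.
rewrite conjgE; apply: (canLR (mulKg _)); rewrite -!fhom.2 //.
apply/esym/hom_eq => //; exact: nw_cat in_commutator_normal _ _ Cg Cx.
Qed.

(** The core in B_n of the kernel of [f]; the kernel itself is a priori normal only in B_n'. *)
Definition normal_kernel w := in_commutator w /\ forall g, f (g ++ w ++ binv g) = 1%g.

Lemma normal_kernel_normal : normal_words normal_kernel.
Proof.
have CN := in_commutator_normal.
split.
- move=> u v uv [Cu fu]; split=> [|g]; first exact: (nw_eq CN uv Cu).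
  rewrite -(fu g); apply/esym/hom_eq; first exact: nw_conj.
  by rewrite uv.
- split=> [|g]; first exact: (nw_nil CN).
  rewrite -hom_nil; apply/esym/hom_eq; first exact: (nw_nil CN).
  by rewrite /= mulwV.
- move=> u v [Cu fu] [Cv fv]; split=> [|g]; first exact: (nw_cat CN).
  have Cgu := nw_conj CN g Cu; have Cgv := nw_conj CN g Cv.
  rewrite -[RHS]mulg1 -{1}(fu g) -(fv g) -fhom.2 //.
  apply/esym/hom_eq; first exact: (nw_cat CN).
  by rewrite -!catA mulVKw.
- move=> u [Cu fu]; split=> [|g]; first exact: (nw_inv CN).
  have -> : g ++ binv u ++ binv g = binv (g ++ u ++ binv g).
    by rewrite !binv_cat binvK catA.
  by rewrite hom_inv ?fu ?invg1 //; exact: (nw_conj CN).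
- move=> h u [Cu fu]; split=> [|g]; first exact: (nw_conj CN).
  by rewrite -(fu (g ++ h)) binv_cat -!catA.
Qed.

(* Conjugating by B_n is no more than conjugating by its commutator subgroup
   when x is centralised by a generator c: multiply g by a power of c. *)
Lemma normal_kernel_centralised c x : intertwines (gen c) x x ->
  in_commutator x -> f x = 1%g -> normal_kernel x.
Proof.
move=> cx Cx fx; split=> // g; pose q := collapse c g.
have qx : intertwines q x x.
  by apply/commutes_sym/intertwines_collapse/commutes_sym.
have gx := intertwines_comp (intertwines_sym qx) (conj_intertwines g x).
have := hom_intertwines (in_commutator_collapse c g) Cx gx.
by rewrite fx => /eqP; rewrite conjg_eq1 => /eqP.
Qed.

Lemma hom_trivial : 5 < n ->
  (forall i j, i = 0 :> nat -> j = 2 :> nat -> f (gen i ++ binv (gen j)) = 1%g) ->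
  forall w, in_commutator w -> f w = 1%g.
Proof.
move=> n5 f02.
pose K i j := normal_kernel (gen i ++ binv (gen j)).
have NK := normal_kernel_normal.
have ltP m : m < 5 -> m < n.-1 by lia.
pose o m (m5 : m < 5) : 'I_n.-1 := Ordinal (ltP m m5).
(* Indices start at zero: [o0], [o2], [o3], [o4] are sigma_1, sigma_3, sigma_4, sigma_5, the last
   existing because n is at least 6. *)
pose o0 := o 0 isT; pose o2 := o 2 isT; pose o3 := o 3 isT; pose o4 := o 4 isT.
have K02 : K o0 o2.
  apply: (normal_kernel_centralised (c := o4)); last exact: f02.
    by apply: intertwines_cat; last apply: intertwines_inv; apply: gen_far.
  exact: in_commutator_gen.
(* Conjugation by sigma_3 sigma_4 fixes sigma_1 and takes sigma_3 to sigma_4, so sigma_3 and sigma_4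
   become identified too. *)
have K03 : K o0 o3.
  apply: (nw_intertwines (g := gen o2 ++ gen o3)) NK _ K02; apply: intertwines_cat.
    by apply: (intertwines_comp (y := gen o0)); apply: gen_far.
  by apply: intertwines_inv; exact: gen_next.
have K23 : K o2 o3.
  have := nw_cat NK (nw_inv NK K02) K03; apply: nw_eq => //.
  by rewrite binv_cat binvK -catA mulVKw.
have up i j l : j = i.+1 :> nat -> l = j.+1 :> nat -> K i j -> K j l.
  move=> ij jl; apply: nw_intertwines NK _.
  have [h1 h2] := gen_shift ij jl.
  by apply: intertwines_cat h1 _; exact: intertwines_inv h2.
have down i j l : j = i.+1 :> nat -> l = j.+1 :> nat -> K j l -> K i j.
  move=> ij jl; apply: nw_intertwines NK _; apply: intertwines_sym.
  have [h1 h2] := gen_shift ij jl.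
  by apply: intertwines_cat h1 _; exact: intertwines_inv h2.
(* The relation between sigma_3 and sigma_4 climbs to all later neighbours by [up]; [down] then
   supplies the two earlier pairs. *)
have Kge d : forall i j, i = d.+2 :> nat -> j = i.+1 :> nat -> K i j.
  elim: d => [|d IH] i j id ij.
    have -> : i = o2 by apply: val_inj.
    by have -> : j = o3 by apply: val_inj; rewrite /= ij id.
  have hP : d.+2 < n.-1 by have := ltn_ord i; lia.
  apply: (up (Ordinal hP)) => //; apply: IH => //.
have K1 : forall i j, j = i.+1 :> nat -> K i j.
  have K12 : K (o 1 isT) o2 by apply: (down _ _ o3).
  move=> i j; case: (ltnP i 2) => i2 ij; last by apply: (Kge (i - 2)) => //; lia.
  case: (posnP i) => i0.
    have -> : i = o0 by apply: val_inj.
    have -> : j = o 1 isT by apply: val_inj; rewrite /= ij i0.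
    exact: (down _ _ o2).
  have -> : i = o 1 isT by apply: val_inj => /=; lia.
  by have -> : j = o2 by apply: val_inj => /=; lia.
move=> w Cw; have Kall i := nw_gen_equal NK K1 i o0.
have [_ /(_ [::])] := nw_commutator NK Kall Cw.
by rewrite /= cats0.
Qed.

End Homomorphism.

End BraidWords.

(** * The commuting family and the braids that transpose it *)

Section EvenGenerators.

Variables (n k : nat).
Hypothesis nk : n./2 = k.+3.

Lemma even_lt (i : nat) : i < k.+3 -> i.*2 < n.-1.
Proof. by move=> ik; move: nk; lia. Qed.

Lemma odd_lt (i : nat) : i < k.+2 -> i.*2.+1 < n.-1.
Proof. by move=> ik; move: nk; lia. Qed.

(** With m = k+3 this is sigma_(2m-1). Even zero-based indices [ev] give sigma_1, sigma_3, ...,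
    sigma_(2m-3). *)
Definition star : 'I_n.-1 := Ordinal (even_lt (ltnSn k.+2)).
Definition ev (i : 'I_k.+2) : 'I_n.-1 := Ordinal (even_lt (ltnW (ltn_ord i))).
Definition od (i : 'I_k.+2) : 'I_n.-1 := Ordinal (odd_lt (ltn_ord i)).

Definition xw (i : 'I_k.+2) : bword n := gen (ev i) ++ binv (gen star).

(** Distinct even indices differ by at least two, so the generators involved commute. *)
Lemma xw_comm_gen (a : 'I_n.-1) (i : 'I_k.+2) :
  ~~ odd a -> intertwines (gen a) (xw i) (xw i).
Proof.
have far_even (b : 'I_n.-1) :
    ~~ odd a -> ~~ odd b -> intertwines (gen a) (gen b) (gen b).
  move=> oa ob; case: (eqVneq a b) => [->|ab]; first exact: beq_refl.
  by apply: gen_far; move: ab; rewrite -val_eqE /=; lia.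
move=> oa; apply: intertwines_cat; last apply: intertwines_inv.
  by apply: far_even => //=; rewrite odd_double.
by apply: far_even => //=; rewrite odd_double.
Qed.

Lemma xw_comm (i j : 'I_k.+2) : intertwines (xw i) (xw j) (xw j).
Proof.
have evenC (a : 'I_n.-1) : ~~ odd a -> intertwines (xw j) (gen a) (gen a).
  by move=> oa; apply/commutes_sym/xw_comm_gen.
apply: commutes_sym; apply: intertwines_cat; last apply: intertwines_inv.
  by apply: evenC; rewrite /= odd_double.
by apply: evenC; rewrite /= odd_double.
Qed.

Definition swapw (i j : 'I_k.+2) : bword n :=
  let h := swap (ev i) (od i) (ev j) in h ++ binv (collapse star h).

(** The transposition sits on the source side because [hom_intertwines] reverses direction. *)
Lemma swapw_intertwines (i j l : 'I_k.+2) : j = i.+1 :> nat ->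
  intertwines (swapw i j) (xw (tperm i j l)) (xw l).
Proof.
move=> ij; pose h := swap (ev i) (od i) (ev j).
have far (b : 'I_n.-1) : (b.+1 < i.*2) || (j.*2.+1 < b) -> intertwines h (gen b) (gen b).
  by move=> hb; do 3?[apply: intertwines_comp]; apply: gen_far => /=; lia.
have [h1 h2] : intertwines h (gen (ev i)) (gen (ev j)) /\
               intertwines h (gen (ev j)) (gen (ev i)).
  by apply: swapP => //=; lia.
apply: (intertwines_comp (y := xw (tperm i j l))).
  apply/intertwines_sym/commutes_sym/intertwines_collapse/commutes_sym.
  by apply: xw_comm_gen; rewrite /= odd_double.
apply: intertwines_cat; last first.
  (* The index of [star] exceeds that of [ev j] by at least two, so [h] fixes it. *)
  by apply/intertwines_inv/far => /=; have := ltn_ord j; lia.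
case: tpermP => [->|->|/eqP li /eqP lj] //.
by apply: far => /=; move: li lj; rewrite -!val_eqE /=; lia.
Qed.

End EvenGenerators.

Theorem theorem1p2 (n : nat) (gT : finGroupType) (f : bword n -> gT) :
  (5 <= n)%N ->
  is_hom_commutator f ->
  (exists w, in_commutator w /\ f w <> 1%g) ->
  (2 ^ (n./2 - 2) * (n./2 - 1)`! <= #|gT|)%N.
Proof.
move=> n5 fhom [w [Cw fw]].
case: (leqP n./2 2) => [n2|n3].
  (* The bound is then 2^0 * 1! = 1. *)
  have -> : n./2 = 2 by lia.
  by apply/card_gt0P; exists 1%g.
have [k nk] : exists k, n./2 = k.+3 by exists (n./2 - 3); lia.
rewrite nk.
have Cx (i : 'I_k.+2) : in_commutator (xw nk i) by exact: in_commutator_gen.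
pose y (i : 'I_k.+2) := f (xw nk i).
have y_comm i j : commute (y i) (y j).
  have := hom_intertwines fhom (Cx j) (Cx i) (xw_comm nk j i).
  by move/conjg_fixP/commgP.
have real : forall s : 'S_k.+2, exists g, forall l, (y l ^ g)%g = y (s l).
  apply: realizable_perm => i j ij; exists (f (swapw nk i j)) => l.
  apply: hom_intertwines => //; first exact: in_commutator_collapse.
  exact: swapw_intertwines.
case: (boolP (injectiveb y)) => [/injectiveP y_inj|/injectivePn[i [j ij yij]]].
  have [c yc] := fin_all_exists real.
  (* The k+2 = m-1 elements yield 2^(k+1) (k+2)!, with k+1 = m-2. *)
  exact: totally_symmetric_card y_inj y_comm yc.
case: fw; apply: (hom_trivial fhom) Cw; first lia.
(* One coincidence [y i = y j] spreads to every pair by double transitivity: [s] sends [i] to [a]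
   and [j] to [b]. *)
have y_const a b : a != b -> y a = y b.
  move=> ab; pose s := (tperm i a * tperm (tperm i a j) b)%g.
  have si : s i = a.
    rewrite permM tpermL tpermD //; last by rewrite eq_sym.
    by rewrite -[X in _ != X](tpermL i a) (inj_eq perm_inj) eq_sym.
  have sj : s j = b by rewrite permM tpermL.
  by have [g yg] := real s; rewrite -si -sj -!yg yij.
move=> a b a0 b2; pose i1 : 'I_k.+2 := lift ord0 ord0.
have -> : a = ev nk ord0 by apply: val_inj.
have -> : b = ev nk i1 by apply: val_inj.
have CN := in_commutator_normal.
(* The factors [star] cancel in x_1 x_2^-1, leaving sigma_1 sigma_3^-1. *)
have -> : f (gen (ev nk ord0) ++ binv (gen (ev nk i1))) = (y ord0 * (y i1)^-1)%g.
  rewrite -(hom_inv fhom) // -fhom.2 //; last exact: (nw_inv (CN n)).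
  apply: (hom_eq fhom); first exact: in_commutator_gen.
  exact/beq_sym/cat_binv_cancel.
by rewrite (y_const ord0 i1) ?mulgV.
Qed.
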